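(* Fix an integer $q\ge 2$. For integers $n\ge 3$ let $S_1=\sqrt{q^2+4(q-1)(n-2)}$, $S_2=\sqrt{q^2+4(q-1)(n-3)}$, and let $c\in\left[0,(q-1)\left(1-\frac{2}{S_1+S_2}\right)\right)$ be such that $$s=\frac{S_1-n(q-2)+2c+q-4}{nq}\in T_n.$$ Then, as $n\to\infty$, $$A_q(n,s)\lesssim\frac{q(q-1)^2n^2}{2(q-c)},$$ i.e. $A_q(n,s)\le(1+o(1))\frac{q(q-1)^2n^2}{2(q-c)}$.
   Context: $T_n=\{-1+\frac{2i}{n}: i=0,1,\dots,n\}$. $A_q(n,s)$ is the maximum cardinality of a code $C$ in the $q$-ary Hamming space $\{0,\dots,q-1\}^n$ with $1-\frac{2d(x,y)}{n}\le s$ for all distinct $x,y\in C$, where $d$ is the Hamming distance. *)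

(* Defs.v *)
From HB Require Import structures.
From mathcomp Require Import all_boot all_order all_algebra.
From mathcomp Require Import reals.
Set Implicit Arguments. Unset Strict Implicit. Unset Printing Implicit Defensive.
Import Order.TTheory GRing.Theory Num.Theory.
Local Open Scope ring_scope.

Definition word (q n : nat) := {ffun 'I_n -> 'I_q}.

Definition hamming (q n : nat) (x y : word q n) : nat := #|[set i | x i != y i]|.

Definition is_code (R : realType) (q n : nat) (s : R) (C : {set word q n}) : bool :=
  [forall x in C, forall y in C,
     (x != y) ==> (1 - 2 * (hamming x y)%:R / n%:R <= s)].

Definition A_q (R : realType) (q n : nat) (s : R) : nat :=
  \max_(C : {set word q n} | is_code s C) #|C|.

Definition in_Tn (R : realType) (n : nat) (s : R) : Prop :=
  exists i : nat, (i <= n)%N /\ s = -1 + 2 * i%:R / n%:R.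

Definition S1 (R : realType) (q n : nat) : R :=
  Num.sqrt (q%:R ^+ 2 + 4 * (q%:R - 1) * (n%:R - 2)).
Definition S2 (R : realType) (q n : nat) : R :=
  Num.sqrt (q%:R ^+ 2 + 4 * (q%:R - 1) * (n%:R - 3)).

Definition s_of (R : realType) (q n : nat) (c : R) : R :=
  (S1 R q n - n%:R * (q%:R - 2) + 2 * c + q%:R - 4) / (n%:R * q%:R).

(* Main.v *)
(* Delsarte's linear programming bound with a quartic polynomial. Put
   w(x,y) = n(q-1) - q d(x,y), a sum over the coordinates of kernels with values q-1
   (agreement) and -1 (disagreement). The elementary symmetric functions e_k of these
   kernels are positive semidefinite and are the Krawtchouk polynomials in w. With
   r = S1/2 and b = c + q/2 - 2, the minimum distance corresponds to w = r + b, so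
   g(w) = (w + n)(w - r - b)(w + r)^2 is nonpositive on distinct codewords. Here
   w is asymptotically Gaussian with standard deviation about r, and
   (u - 1)(u + 1)^2 = H_3 + H_2 + 2 H_1 in Hermite polynomials: the coefficients of
   e_1, ..., e_4 in g are nonnegative for large n, while the leading part of the
   constant coefficient cancels, leaving f_0 = n r^2 (2(q - c) + O(1/r)). Then
   |C| <= g(n(q-1)) / f_0, which is the claimed bound up to 1 + o(1). *)
Require Import Defs.
From HB Require Import structures.
From mathcomp Require Import all_boot all_order all_algebra.
From mathcomp Require Import reals.
From mathcomp Require Import ring lra.
Import Order.TTheory GRing.Theory Num.Theory.
Local Open Scope ring_scope.

(** * Elementary symmetric functions: generating polynomial and recurrence *)

Definition genpoly {R : nzRingType} {I : Type} (z : I -> R) (s : seq I) : {poly R} :=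
  \prod_(i <- s) (1 + z i *: 'X).

(* As [(z i - rho) * (z i + 1) = 0], the factor [1 + z i *: 'X] divides
   [(1 - 'X) * (1 + rho *: 'X)], the polynomial on the left. Comparing
   coefficients gives the Krawtchouk recurrence. *)
Lemma genpoly_deriv {R : comNzRingType} {I : Type} (rho : R) (z : I -> R) (s : seq I) :
  (forall i, z i ^+ 2 = rho + (rho - 1) * z i) ->
  (1 + (rho - 1) *: 'X - rho *: 'X^2) * (genpoly z s)^`()
  = ((\sum_(i <- s) z i)%:P - (rho * (size s)%:R) *: 'X) * genpoly z s.
Proof.
move=> z_quad; rewrite /genpoly; elim: s => [|i s IHs].
  by rewrite !big_nil -polyC1 derivC /= !mulr0 scale0r subr0 polyC0 mul0r.
rewrite !big_cons derivM derivD -polyC1 derivC add0r derivZ derivX polyC1.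
rewrite [LHS]mulrDr [_ * (_ * _^`())]mulrCA IHs polyCD /=.
set P := \prod_(j <- s) _; set S := \sum_(j <- s) _.
rewrite -natr1 mulrDr mulr1.
have zq : (z i)%:P ^+ 2 = rho%:P + (rho%:P - 1) * (z i)%:P :> {poly R}.
  by rewrite -polyC_exp z_quad polyCD polyCM polyCB polyC1.
rewrite -!mul_polyC !(polyCB, polyCD, polyCM) polyC1.
ring: zq.
Qed.

Lemma genpoly_coef0 {R : comNzRingType} {I : Type} (z : I -> R) (s : seq I) :
  (genpoly z s)`_0 = 1.
Proof.
rewrite -horner_coef0 horner_prod big1 // => i _.
by rewrite !hornerE.
Qed.

Lemma genpoly_coef1 {R : comNzRingType} {I : Type} (rho : R) (z : I -> R) (s : seq I) :
  (forall i, z i ^+ 2 = rho + (rho - 1) * z i) ->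
  (genpoly z s)`_1 = \sum_(i <- s) z i.
Proof.
move=> /(genpoly_deriv _ _ s)/(congr1 (fun p : {poly R} => p`_0)).
rewrite !mulrBl !mulrDl mul1r -!scalerAl !coefB coefD !coefZ.
rewrite mul_polyC coefZ !coefXM coefXnM coef_deriv /= genpoly_coef0.
by rewrite mulr1n mulr1 !mulr0 addr0 !subr0.
Qed.

Lemma genpoly_coefSS {R : comNzRingType} {I : Type} (rho : R) (z : I -> R) (s : seq I)
    (k : nat) :
  (forall i, z i ^+ 2 = rho + (rho - 1) * z i) ->
  k.+2%:R * (genpoly z s)`_k.+2 =
  (\sum_(i <- s) z i - (rho - 1) * k.+1%:R) * (genpoly z s)`_k.+1
  - rho * ((size s)%:R - k%:R) * (genpoly z s)`_k.
Proof.
move=> z_quad.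
have := congr1 (fun p : {poly R} => p`_k.+1) (genpoly_deriv rho z s z_quad).
set P := genpoly z s; set w := \sum_(i <- s) z i.
have -> : (1 + (rho - 1) *: 'X - rho *: 'X^2) * P^`()
    = P^`() + (rho - 1) *: ('X * P^`()) - rho *: ('X * ('X * P^`())).
  by rewrite -!mul_polyC; ring.
have -> : (w%:P - (rho * (size s)%:R) *: 'X) * P
    = w *: P - (rho * (size s)%:R) *: ('X * P).
  by rewrite -!mul_polyC; ring.
rewrite !coefB coefD !coefZ !coefXM !coef_deriv /=.
(* At k = 0 both sides are 0, so one formula serves every k. *)
have -> : (if k == 0%N then 0 else P`_k.-1.+1 *+ k.-1.+1) = P`_k *+ k.
  by case: k => [|k]; rewrite ?mulr0n.
move=> H; rewrite mulr_natl.
move/eqP: H; rewrite subr_eq => /eqP H.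
rewrite -[LHS](addrK ((rho - 1) * (P`_k.+1 *+ k.+1))) H.
ring.
Qed.

(** * Coordinate kernels, positive semidefiniteness, linear programming bound *)

Definition coord_kernel {R : nzRingType} {q n : nat} (x y : word q n) (i : 'I_n) : R :=
  if x i == y i then q%:R - 1 else -1.

Lemma coord_kernel_quad {R : comNzRingType} {q n : nat} (x y : word q n) (i : 'I_n) :
  coord_kernel x y i ^+ 2
  = q%:R - 1 + (q%:R - 1 - 1) * coord_kernel x y i :> R.
Proof. by rewrite /coord_kernel; case: ifP => _; ring. Qed.

Lemma sum_coord_kernel {R : comNzRingType} {q n : nat} (x y : word q n) :
  \sum_i coord_kernel x y i = n%:R * (q%:R - 1) - q%:R * (hamming x y)%:R :> R.
Proof.
rewrite (eq_bigr (fun i => (q%:R - 1) - q%:R * (x i != y i)%:R)); last first.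
  by move=> i _; rewrite /coord_kernel; case: ifP => _ /=; ring.
rewrite sumrB sumr_const card_ord -mulr_sumr -natr_sum; congr (_ - _ * _%:R).
  by rewrite mulr_natl.
by rewrite -big_mkcond /= sum1_card /hamming cardsE.
Qed.

(** The vectors with entries q [a = t] - 1 have inner products q^2 [a = b] - q. *)
Lemma coord_kernel_gram {R : fieldType} {q : nat} (a b : 'I_q) :
  q%:R != 0 :> R ->
  (if a == b then q%:R - 1 else -1) =
  q%:R^-1 * \sum_t (q%:R * (a == t)%:R - 1) * (q%:R * (b == t)%:R - 1) :> R.
Proof.
move=> q0.
have sd (c : 'I_q) (F : 'I_q -> R) : \sum_t (c == t)%:R * F t = F c.
  rewrite (bigD1 c) //= eqxx mul1r big1 ?addr0 // => t.
  by rewrite eq_sym => /negbTE ->; rewrite mul0r.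
have -> : \sum_t (q%:R * (a == t)%:R - 1) * (q%:R * (b == t)%:R - 1) =
   \sum_t (a == t)%:R * (q%:R * (q%:R * (b == t)%:R - 1)) -
   \sum_t (b == t)%:R * q%:R + \sum_(t < q) 1 :> R.
  by rewrite -sumrB -big_split; apply: eq_bigr => t _ /=; ring.
rewrite !sd sumr_const card_ord eq_sym.
by case: ifP => _ /=; rewrite ?mulr1n ?mulr0n; field.
Qed.

(* The factorized form [F_g x * F_g y] of each term is what makes every
   coefficient a positive semidefinite kernel. *)
Lemma genpoly_gram {R : fieldType} {q n : nat} (x y : word q n) :
  q%:R != 0 :> R ->
  genpoly (coord_kernel x y) (index_enum 'I_n) =
  \sum_(g : {ffun 'I_n -> bool * 'I_q})
    (q%:R^-1 ^+ n *
      (\prod_i (if (g i).1 then q%:R * (x i == (g i).2)%:R - 1 else 1)) *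
      (\prod_i (if (g i).1 then q%:R * (y i == (g i).2)%:R - 1 else 1))) *:
    'X^(\sum_i (g i).1) :> {poly R}.
Proof.
move=> q0.
(* The Boolean picks a summand of the factor at [i]: the kernel times ['X], or 1. For the summand 1
   the letter is a dummy: q equal terms of weight 1/q add up to 1. *)
pose F (i : 'I_n) (u : bool * 'I_q) : {poly R} :=
  (q%:R^-1 * (if u.1 then q%:R * (x i == u.2)%:R - 1 else 1) *
   (if u.1 then q%:R * (y i == u.2)%:R - 1 else 1)) *: 'X^(u.1 : nat).
transitivity (\prod_i \sum_u F i u).
  apply: eq_bigr => i _.
  rewrite -(pair_bigA _ (fun b t => F i (b, t))) /= big_bool /F /= addrC.
  rewrite -!scaler_suml; congr (_ + _ *: _).
    rewrite -[LHS]scale1r; congr (_ *: _).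
    by rewrite sumr_const card_ord !mulr1 -[_^-1 *+ _]mulr_natr mulVf.
  rewrite /coord_kernel (coord_kernel_gram _ _ q0) mulr_sumr.
  by apply: eq_bigr => t _; rewrite mulrA.
rewrite bigA_distr_bigA /=; apply: eq_bigr => g _.
rewrite /F scaler_prod !big_split /= prodr_const card_ord; congr (_ *: _).
by rewrite -prodrXr.
Qed.

(** In the expansion [genpoly_gram] each index [g] contributes a nonnegative multiple of the square
    of a sum over [C]. *)
Lemma sum_genpoly_coef_ge0 {R : realFieldType} {q n : nat} (C : {set word q n}) (k : nat) :
  (0 < q)%N ->
  0 <= \sum_(x in C) \sum_(y in C)
         (genpoly (coord_kernel x y) (index_enum 'I_n) : {poly R})`_k.
Proof.
move=> q_gt0; have q0 : q%:R != 0 :> R by rewrite pnatr_eq0 -lt0n.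
under eq_bigr => x _ do under eq_bigr => y _ do
  rewrite (genpoly_gram _ _ q0) coef_sum.
under eq_bigr => x _ do rewrite exchange_big /=.
rewrite exchange_big /=; apply: sumr_ge0 => g _.
set A := fun x : word q n =>
  \prod_i (if (g i).1 then q%:R * (x i == (g i).2)%:R - 1 else 1) : R.
rewrite (_ : \sum_(x in C) _ =
    q%:R^-1 ^+ n * (\sum_(x in C) A x) ^+ 2 * ('X^(\sum_i (g i).1))`_k).
  apply: mulr_ge0; last by rewrite coefXn ler0n.
  by rewrite mulr_ge0 ?sqr_ge0 // exprn_ge0 // invr_ge0 ler0n.
rewrite expr2 mulr_sumr mulr_sumr mulr_suml; apply: eq_bigr => x _.
rewrite mulr_suml mulr_sumr mulr_suml; apply: eq_bigr => y _.
by rewrite coefZ -/(A x) -/(A y); ring.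
Qed.

(** Sum [g] over all pairs of codewords: the terms with k > 0 are nonnegative and e_0 = 1, which
    bounds the sum from below; the diagonal bounds it from above. Keeping the factor |C| covers the
    empty code. *)
Lemma delsarte_lp_bound {R : realFieldType} {q n : nat} (C : {set word q n})
    (D : nat) (f : nat -> R) (g : R -> R) :
  (0 < q)%N -> (forall k, 0 <= f k.+1) ->
  (forall x y : word q n,
     g (n%:R * (q%:R - 1) - q%:R * (hamming x y)%:R) =
     \sum_(k < D.+1) f k * (genpoly (coord_kernel x y) (index_enum 'I_n))`_k) ->
  {in C &, forall x y, x != y ->
     g (n%:R * (q%:R - 1) - q%:R * (hamming x y)%:R) <= 0} ->
  #|C|%:R * (#|C|%:R * f 0%N) <= #|C|%:R * g (n%:R * (q%:R - 1)).
Proof.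
move=> q_gt0 f_ge0 gE g_le0.
pose G (x y : word q n) := g (n%:R * (q%:R - 1) - q%:R * (hamming x y)%:R).
have lb : #|C|%:R * (#|C|%:R * f 0%N) <= \sum_(x in C) \sum_(y in C) G x y.
  under eq_bigr => x _ do under eq_bigr => y _ do rewrite /G gE big_ord_recl.
  under eq_bigr => x _ do rewrite big_split /=.
  rewrite big_split /= -[X in X <= _]addr0; apply: lerD.
    under eq_bigr => x _ do
      (under eq_bigr => y _ do rewrite genpoly_coef0 mulr1; rewrite sumr_const).
    by rewrite sumr_const !mulr_natl.
  under eq_bigr => x _ do rewrite exchange_big /=.
  rewrite exchange_big /=; apply: sumr_ge0 => k _.
  under eq_bigr => x _ do rewrite -mulr_sumr.
  by rewrite -mulr_sumr mulr_ge0 // sum_genpoly_coef_ge0.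
apply: (le_trans lb); rewrite mulr_natl -sumr_const; apply: ler_sum => x xC.
rewrite (bigD1 x) //= -[X in _ <= X]addr0; apply: lerD.
  rewrite /G (_ : hamming x x = 0%N) ?mulr0 ?subr0 //.
  by apply/eqP; rewrite cards_eq0; apply/eqP/setP => i; rewrite !inE eqxx.
by apply: sumr_le0 => y /andP[yC yx]; apply: g_le0; rewrite // eq_sym.
Qed.

(** * The quartic test polynomial and its expansion *)

(* In the variable [w], [- n] is distance [n] and [r + b] is the minimum distance;
   [- r] is the double root. *)
Definition quartic {R : fieldType} (n r b w : R) : R :=
  (w + n) * (w - (r + b)) * (w + r) ^+ 2.

(* Krawtchouk coefficients of [quartic], for alphabet size [rho + 1]. *)
Definition quartic_coef {R : fieldType} (rho n r b : R) (k : nat) : R :=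
  let p := rho - 1 in let m := rho * n in let t := p ^+ 2 - 2 * rho in
  let u2 := n * (r - b) - r ^+ 2 - 2 * b * r in
  match k with
  | 0 => m * (3 * m + t) + (n + r - b) * p * m + u2 * m - n * (r ^+ 3 + b * r ^+ 2)
  | 1 => p * (10 * m - 6 * rho + t) + (n + r - b) * (3 * m + t)
         + p * u2 - n * (r ^+ 2 + 2 * b * r) - r ^+ 3 - b * r ^+ 2
  | 2 => 12 * m - 16 * rho + 14 * p ^+ 2 + 6 * p * (n + r - b) + 2 * u2
  | 3 => 36 * p + 6 * (n + r - b)
  | 4 => 24
  | _ => 0
  end.

Lemma quartic_expansion {R : numFieldType} (rho n r b w : R) (e : nat -> R) :
  e 0%N = 1 -> e 1%N = w ->
  (forall k, k.+2%:R * e k.+2 =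
     (w - (rho - 1) * k.+1%:R) * e k.+1 - rho * (n - k%:R) * e k) ->
  quartic n r b w = \sum_(k < 5) quartic_coef rho n r b k * e k.
Proof.
move=> e0 e1 eS; rewrite !big_ord_recl big_ord0 /= /bump /= !add1n.
have e2 : e 2%N = ((w - (rho - 1)) * w - rho * n) / 2.
  have := eS 0%N; rewrite e0 e1 => H; apply: (@mulfI _ 2); first by rewrite pnatr_eq0.
  by rewrite H; field.
have e3 : e 3%N = ((w - 2 * (rho - 1)) * e 2%N - rho * (n - 1) * w) / 3.
  have := eS 1%N; rewrite e1 => H; apply: (@mulfI _ 3); first by rewrite pnatr_eq0.
  by rewrite H; field.
have e4 : e 4%N = ((w - 3 * (rho - 1)) * e 3%N - rho * (n - 2) * e 2%N) / 4.
  have := eS 2%N => H; apply: (@mulfI _ 4); first by rewrite pnatr_eq0.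
  by rewrite H; field.
rewrite e4 e3 e2 e1 e0 /quartic; by field.
Qed.

(** * Asymptotics for large r, uniform in b *)

Lemma affine_poly_littleo {R : realFieldType} (k : nat) (al be : nat -> R) (B eps : R) :
  0 < eps ->
  exists L, forall r b, L <= r -> `|b| <= B ->
    `|\sum_(i < k) (al i + be i * b) * r ^+ i| <= eps * r ^+ k.
Proof.
move=> eps0; pose K := \sum_(i < k) (`|al i| + `|be i| * B).
(* From r >= 1 follows r^(i+1) <= r^k; the second summand gives K <= eps r. *)
exists (1 + `|K| / eps) => r b rL bB.
have Ke0 : 0 <= `|K| / eps by rewrite divr_ge0 // ltW.
have r1 : 1 <= r by lra.
have r0 : 0 < r by lra.
have rK : K <= eps * r.
  rewrite (le_trans (ler_norm _)) // -ler_pdivrMl // mulrC; lra.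
rewrite -(ler_pM2l r0); apply: (@le_trans _ R (K * r ^+ k)); last first.
  by rewrite mulrCA mulrA ler_wpM2r // exprn_ge0 // ltW.
rewrite -[r in r * _]gtr0_norm // -normrM mulr_sumr (le_trans (ler_norm_sum _ _ _)) //.
rewrite mulr_suml; apply: ler_sum => i _.
rewrite mulrCA normrM; apply: ler_pM => //.
  by rewrite (le_trans (ler_normD _ _)) // normrM lerD2l ler_wpM2l.
by rewrite -exprS normrX gtr0_norm // ler_weXn2l.
Qed.

(** With rho = q - 1, the equation for [rho * n] is the definition of r = S1/2, squared, and
    [3 * rho - 1 - 2 * b] is 2(q - c). As [L] precedes [b], the threshold is uniform in c. *)
Lemma quartic_bound_eventually {R : realFieldType} (rho B eps : R) :
  0 < rho -> 0 < eps ->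
  exists L, forall r b n : R,
    L <= r -> `|b| <= B -> 0 < n -> rho * n = r ^+ 2 - ((rho + 1) ^+ 2 / 4 - 2 * rho) ->
    (forall k, 0 <= quartic_coef rho n r b k.+1) /\
    (forall N, 0 <= N -> 2 <= 3 * rho - 1 - 2 * b ->
       N * quartic_coef rho n r b 0 <= quartic n r b (rho * n) ->
       N <= (1 + eps) * ((rho + 1) * (rho * n) ^+ 2 / (3 * rho - 1 - 2 * b))).
Proof.
move=> rho0 eps0.
pose p := rho - 1; pose t := p ^+ 2 - 2 * rho.
pose ka := (rho + 1) ^+ 2 / 4 - 2 * rho.
(* Below, the coefficient lists are those of [rho * quartic_coef _ k] ([k = 3, 2, 1])
   and of [quartic_coef _ 0 / n] as polynomials in [r], without the leading term. *)
pose d := Num.min eps 1 / 8.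
have [d0 d1 d2] : [/\ 0 < d, d <= 1 / 8 & 8 * d <= eps].
  rewrite /d; case: (leP eps 1) => ?; split; lra.
(* The tolerances 6, 2, 2 are the leading coefficients for k = 3, 2, 1, so the lower terms cannot
   make these polynomials negative. *)
have [L3 H3] := @affine_poly_littleo R 2
  (nth 0 [:: 36 * p * rho - 6 * ka; 6 * rho]) (nth 0 [:: - 6 * rho]) B 6 ltac:(lra).
have [L2 H2] := @affine_poly_littleo R 3
  (nth 0 [:: - 12 * rho * ka - 16 * rho ^+ 2 + 14 * rho * p ^+ 2 - 6 * p * ka;
             6 * p * rho - 2 * ka; 10 * rho + 6 * p])
  (nth 0 [:: - 6 * p * rho + 2 * ka; - 4 * rho; - 2]) B 2 ltac:(lra).
have [L1 H1] := @affine_poly_littleo R 4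
  (nth 0 [:: - 10 * rho * p * ka - 6 * p * rho ^+ 2 + p * rho * t + 3 * ka ^+ 2 - t * ka;
             - 3 * rho * ka + rho * t - p * ka; 9 * rho * p - 5 * ka + t; 2 * rho + p])
  (nth 0 [:: 3 * rho * ka - rho * t + p * ka; - 2 * p * rho + 2 * ka;
             - 4 * rho - p; - 2]) B 2 ltac:(lra).
have [L0 H0] := @affine_poly_littleo R 2
  (nth 0 [:: - 3 * rho * ka + rho * t - p * ka; p * rho - ka])
  (nth 0 [:: - p * rho + ka; - 2 * rho]) B d d0.
have [Lk Hk] := @affine_poly_littleo R 2 (nth 0 [:: - ka]) (fun=> 0) B d d0.
have [Lr Hr] := @affine_poly_littleo R 2 (nth 0 [:: - ka; 1]) (fun=> 0) B d d0.
exists (Num.max 1 (Num.max B (Num.max L0 (Num.max L1 (Num.max L2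
         (Num.max L3 (Num.max Lk Lr))))))) => r b n rL bB n0 rn.
move: rL; rewrite !ge_max => /and5P[r1 rB rL0 rL1 /and4P[rL2 rL3 rLk rLr]].
have [b1 b2] : - B <= b /\ b <= B by move: bB; rewrite ler_norml => /andP[].
move: (H0 _ _ rL0 bB) (H1 _ _ rL1 bB) (H2 _ _ rL2 bB) (H3 _ _ rL3 bB).
move: (Hk _ _ rLk bB) (Hr _ _ rLr bB).
rewrite !big_ord_recl !big_ord0 /= /bump /= !add1n.
rewrite !ler_norml => /andP[{}Hk _] /andP[_ {}Hr] /andP[{}H0 _] /andP[{}H1 _]
  /andP[{}H2 _] /andP[{}H3 _].
have rho_neq0 : rho != 0 by rewrite gt_eqF.
have nE : n = (r ^+ 2 - ka) / rho by rewrite /ka -rn mulrAC divff ?mul1r.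
have ge0_eq (x y : R) : 0 <= x -> x = y -> 0 <= y by move=> + <-.
split.
  move: H1 H2 H3; rewrite -![- _ <= _]subr_ge0 => H1 H2 H3 k.
  rewrite -(pmulr_rge0 _ rho0); case: k => [|[|[|[|k]]]] /=; rewrite -/p -/t.
  - by apply: (ge0_eq _ _ H1); rewrite nE; field.
  - by apply: (ge0_eq _ _ H2); rewrite nE; field.
  - by apply: (ge0_eq _ _ H3); rewrite nE; field.
  - by rewrite mulr_ge0 // ltW.
  - by rewrite mulr0.
move=> N N0 T2.
set T := 3 * rho - 1 - 2 * b in T2 *.
set m := rho * n in rn *.
have m0 : 0 < m by rewrite mulr_gt0.
have r2 : 0 < r ^+ 2 by rewrite exprn_gt0 //; lra.
(* The constant coefficient divided by n: its r^3 terms cancel, and [T] is what remains at r^2. *)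
pose Q := T * r ^+ 2 + ((p * rho - ka - 2 * rho * b) * r
  + (- 3 * rho * ka + rho * t - p * ka + (- p * rho + ka) * b)).
rewrite [X in N * X](_ : _ = n * Q); last first.
  by rewrite /Q /T /m nE /t /p; field.
have -> : quartic n r b m = n * ((rho + 1) * ((m - (r + b)) * (m + r) ^+ 2)).
  by rewrite /quartic /m; ring.
rewrite mulrCA ler_pM2l // => NQ.
(* Since T >= 1, the absolute error d r^2 is at most T d r^2. *)
have QT : T * (1 - d) * r ^+ 2 <= Q.
  have : d * r ^+ 2 <= T * (d * r ^+ 2).
    by apply: ler_peMl; [rewrite ltW // mulr_gt0|lra].
  by move: H0; rewrite /Q expr0 expr1; lra.
have mr : m + r <= (1 + d) * r ^+ 2.
  by move: Hr; rewrite rn -/ka expr0 expr1; lra.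
have rm : (1 - d) * r ^+ 2 <= m.
  by move: Hk; rewrite rn -/ka expr0 expr1; lra.
(* Dropping r + b requires it to be nonnegative, hence [B] in the threshold for r. *)
have le1 : (m - (r + b)) * (m + r) ^+ 2 <= m * ((1 + d) * r ^+ 2) ^+ 2.
  apply: (@le_trans _ R (m * (m + r) ^+ 2)).
    by rewrite ler_wpM2r ?sqr_ge0 //; lra.
  by rewrite ler_wpM2l ?(ltW m0) // ler_sqr ?nnegrE //; lra.
have le2 : N * T * (1 - d) <= (rho + 1) * m * (1 + d) ^+ 2 * r ^+ 2.
  have rho1 : 0 <= rho + 1 by lra.
  have := le_trans (le_trans (ler_wpM2l N0 QT) NQ) (ler_wpM2l rho1 le1).
  rewrite -(ler_pM2r r2 (N * T * (1 - d))) => H.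
  have -> : N * T * (1 - d) * r ^+ 2 = N * (T * (1 - d) * r ^+ 2) by ring.
  by apply: (le_trans H); rewrite le_eqVlt; apply/orP; left; apply/eqP; ring.
have le3 : N * T * (1 - d) ^+ 2 <= (rho + 1) * m ^+ 2 * (1 + d) ^+ 2.
  apply: (@le_trans _ R ((rho + 1) * m * (1 + d) ^+ 2 * r ^+ 2 * (1 - d))).
    by rewrite expr2 mulrA ler_wpM2r //; lra.
  rewrite -mulrA [r ^+ 2 * _]mulrC.
  rewrite [X in _ <= X](_ : _ = (rho + 1) * m * (1 + d) ^+ 2 * m); last by ring.
  rewrite ler_wpM2l // !mulr_ge0 ?sqr_ge0 ?(ltW m0) //; lra.
(* The 8 in [d]: (1 + d)^2 <= (1 + 8d)(1 - d)^2 for 0 <= d <= 1/8. *)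
have dd : (1 + d) ^+ 2 <= (1 + eps) * (1 - d) ^+ 2.
  apply: (@le_trans _ R ((1 + 8 * d) * (1 - d) ^+ 2)); first by nra.
  by rewrite ler_wpM2r ?sqr_ge0 //; lra.
have T0 : 0 < T by lra.
rewrite mulrA ler_pdivlMr //.
have d3 : 0 < (1 - d) ^+ 2 by rewrite exprn_gt0 //; lra.
rewrite -(ler_pM2r d3) (le_trans le3) //.
rewrite [X in _ <= X](_ : _ = (rho + 1) * m ^+ 2 * ((1 + eps) * (1 - d) ^+ 2)); last by ring.
by rewrite ler_wpM2l // mulr_ge0 ?sqr_ge0 //; lra.
Qed.

(** * From codes to the asymptotic bound *)

Lemma card_code_le {R : realType} {q n : nat} {s B : R} :
  (forall C : {set word q n}, is_code s C -> #|C|%:R <= B) -> (A_q q n s)%:R <= B.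
Proof.
move=> H; rewrite /A_q; apply: (big_ind (fun k : nat => k%:R <= B)) => //.
  by rewrite -(cards0 (word q n)); apply: H; apply/forall_inP => x; rewrite inE.
by move=> k l kB lB; rewrite /maxn; case: ifP.
Qed.

(** Clearing the denominator n q of [s_of] turns the threshold s into r + b. *)
Lemma is_code_kernel_le {R : realType} {q n : nat} {c : R} {C : {set word q n}} :
  (0 < q)%N -> (0 < n)%N -> is_code (s_of q n c) C ->
  {in C &, forall x y, x != y ->
     n%:R * (q%:R - 1) - q%:R * (hamming x y)%:R
     <= S1 R q n / 2 + (c + q%:R / 2 - 2)}.
Proof.
move=> q0 n0 /forall_inP codeC x y xC yC xy.
have /forall_inP/(_ y yC)/implyP/(_ xy) := codeC x xC.
have qR : 0 < q%:R :> R by rewrite ltr0n.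
have nR : 0 < n%:R :> R by rewrite ltr0n.
rewrite /s_of ler_pdivlMr ?mulr_gt0 //.
have -> : (1 - 2 * (hamming x y)%:R / n%:R) * (n%:R * q%:R) =
          n%:R * q%:R - 2 * (hamming x y)%:R * q%:R :> R.
  by field; rewrite gt_eqF.
lra.
Qed.

Theorem theorem6 (R : realType) (q : nat) (hq : (2 <= q)%N) :
  forall eps : R, 0 < eps ->
  exists N : nat, forall (n : nat) (c : R),
    (N <= n)%N -> (3 <= n)%N ->
    0 <= c ->
    c < (q%:R - 1) * (1 - 2 / (S1 R q n + S2 R q n)) ->
    in_Tn n (s_of q n c) ->
    (A_q q n (s_of q n c))%:R
      <= (1 + eps) * (q%:R * (q%:R - 1) ^+ 2 * n%:R ^+ 2 / (2 * (q%:R - c))).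
Proof.
move=> eps eps0.
have q2 : 2 <= q%:R :> R by rewrite (ler_nat R 2).
have rho0 : 0 < q%:R - 1 :> R by lra.
have [L HL] := quartic_bound_eventually (q%:R - 1) (2 * q%:R) eps rho0 eps0.
(* This gives L^2 <= n - 2, while r^2 = q^2/4 + (q - 1)(n - 2) >= n - 2. *)
exists (Num.truncn (L ^+ 2)).+3 => n c nN n3 c0 c_lt _.
have n0 : 0 < n%:R :> R by rewrite ltr0n (leq_trans _ n3).
have n3R : 3 <= n%:R :> R by rewrite (ler_nat R 3).
(* Hence q - c >= 1, which keeps the denominator away from 0, and |b| <= 2q. *)
have c1 : c <= q%:R - 1.
  apply/ltW/(lt_le_trans c_lt)/ler_piMr; first by rewrite ltW.
  by rewrite gerBl divr_ge0 // addr_ge0 // sqrtr_ge0.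
set r := S1 R q n / 2; set b := c + q%:R / 2 - 2.
have S1sq : S1 R q n ^+ 2 = q%:R ^+ 2 + 4 * (q%:R - 1) * (n%:R - 2).
  by rewrite sqr_sqrtr // addr_ge0 ?sqr_ge0 // !mulr_ge0 //; lra.
have r0 : 0 <= r by rewrite divr_ge0 // sqrtr_ge0.
have rn : (q%:R - 1) * n%:R =
    r ^+ 2 - ((q%:R - 1 + 1) ^+ 2 / 4 - 2 * (q%:R - 1)).
  by rewrite /r expr_div_n S1sq; field.
have Lr : L <= r.
  have L2 : L ^+ 2 <= n%:R - 2.
    rewrite lerBrDr (le_trans (_ : _ <= (Num.truncn (L ^+ 2)).+1%:R + 2)) //.
      by rewrite lerD2r ltW // truncnS_gt.
    by rewrite -natrD ler_nat addn2.
  apply: (le_trans (ler_norm L)); rewrite -ler_sqr ?nnegrE // real_normK ?num_real //.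
  apply: (le_trans L2); rewrite /r expr_div_n S1sq.
  have : n%:R - 2 <= (q%:R - 1) * (n%:R - 2) :> R by rewrite ler_peMl //; lra.
  have := sqr_ge0 (q%:R : R); lra.
have bB : `|b| <= 2 * q%:R by rewrite ler_norml /b; apply/andP; split; lra.
have [f_ge0 f0_bound] := HL r b n%:R Lr bB n0 rn.
apply: card_code_le => C codeC.
have -> : q%:R * (q%:R - 1) ^+ 2 * n%:R ^+ 2 / (2 * (q%:R - c)) =
  (q%:R - 1 + 1) * ((q%:R - 1) * n%:R) ^+ 2 / (3 * (q%:R - 1) - 1 - 2 * b).
  rewrite /b; field; apply/andP; split; rewrite gt_eqF //; lra.
have [->|C_neq0] := eqVneq C set0.
  rewrite cards0 mulr_ge0 ?divr_ge0 ?mulr_ge0 ?sqr_ge0 // /b; lra.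
apply: f0_bound => //; first by rewrite /b; lra.
have CR : 0 < #|C|%:R :> R by rewrite ltr0n card_gt0.
rewrite -(ler_pM2l CR) [(q%:R - 1) * n%:R]mulrC.
apply: (delsarte_lp_bound C 4 (quartic_coef (q%:R - 1) n%:R r b)) => //.
- by rewrite (leq_trans _ hq).
- move=> x y; rewrite -sum_coord_kernel.
  apply: (quartic_expansion _ _ _ _ _
    (fun k => (genpoly (coord_kernel x y) (index_enum 'I_n))`_k)).
  + exact: genpoly_coef0.
  + apply: genpoly_coef1; exact: coord_kernel_quad.
  + move=> k; rewrite (genpoly_coefSS (q%:R - 1)); last exact: coord_kernel_quad.
    by rewrite [index_enum _]unlock -enumT size_enum_ord.
move=> x y xC yC xy.
have w_le := is_code_kernel_le (leq_trans _ hq) (leq_trans _ n3) codeC x y xC yC xy.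
(* At distance d the factor w + n is q (n - d) >= 0. *)
rewrite /quartic -/r -/b mulr_le0_ge0 ?sqr_ge0 // mulr_ge0_le0 //.
  have : (hamming x y)%:R <= n%:R :> R.
    by rewrite ler_nat -[n in (_ <= n)%N]card_ord max_card.
  move=> h; have : q%:R * (hamming x y)%:R <= q%:R * n%:R :> R by rewrite ler_wpM2l.
  lra.
by rewrite subr_le0 w_le.
Qed.
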